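(* Let $G$ be a compactly generated locally compact Hausdorff topological group, and let $\alpha$ be the canonical action of $G$ on $B^{\infty}(G)$, the closed unit ball of $L^1(G)'$ with the weak-$^{\ast}$ topology, given by $\alpha(g,l)(f) = l(f \circ \lambda_G(g))$. Let $S$ be a compact generating subset of $G$ and let $k = \inf\{ n \in \mathbb{N} \mid S^n \text{ is an identity neighborhood of } G\}$ (this set is nonempty). If $G$ is not compact, then there exists a two-element open covering $\mathcal{V}$ of $B^{\infty}(G)$ such that $$\eta(\alpha,S,\mathcal{V}) \geq \frac{1}{2k}.$$
   Context: $\mathbb{N}$ is the set of natural numbers excluding $0$. A subset $S \subseteq G$ generates $G$ if $S$ contains the neutral element $e_G$ and $G = \bigcup_{n\in\mathbb{N}} S^n$, where $S^n = \{s_1\cdots s_n \mid s_i \in S\}$; $G$ is compactly generated if it has a compact generating subset. An identity neighborhood of $G$ is a neighborhood of $e_G$ (a set, not necessarily open, whose interior contains $e_G$). Fix $\mathbb{K} \in \{\mathbb{R},\mathbb{C}\}$ and a left Haar measure $\mu$ on $G$; $L^1(G)$ is the Banach space of ($\mathbb{K}$-valued) $\mu$-integrable functions (modulo null functions) with norm $\|\cdot\|_1$, and $L^1(G)'$ is its dual Banach space. $B^{\infty}(G)$ is the closed unit ball of $L^1(G)'$ endowed with the weak-$^{\ast}$ topology, i.e., the initial topology with respect to the maps $B^\infty(G)\to\mathbb{K}$, $l \mapsto l(f)$, $f \in L^1(G)$; it is a compact Hausdorff space. For $g \in G$, $\lambda_G(g)\colon G \to G$, $x \mapsto gx$. The map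 $\alpha \colon G \times B^{\infty}(G) \to B^{\infty}(G)$, $\alpha(g,l)(f) = l(f\circ\lambda_G(g))$ ($f \in L^1(G)$), is a continuous action of $G$ on $B^{\infty}(G)$. Entropy. Let $\alpha$ be a continuous action of a topological group $G$ on a compact Hausdorff space $X$. $\mathcal{C}(X)$ is the set of finite open coverings of $X$. For $\mathcal{U},\mathcal{V} \in \mathcal{C}(X)$ and $S \subseteq G$, write $\mathcal{U} \preceq_S^{\alpha} \mathcal{V}$ if for every $g \in S$ and every $V \in \mathcal{V}$ there is $U \in \mathcal{U}$ with $\alpha(g,V) = \{\alpha(g,x) \mid x\in V\} \subseteq U$. For compact $S \subseteq G$, $(S:\mathcal{U})_{\alpha} = \inf\{|\mathcal{V}| \mid \mathcal{V} \in \mathcal{C}(X),\ \mathcal{U} \preceq_S^{\alpha}\mathcal{V}\}$ (this is finite). For a compact generating subset $S$ of $G$, $\eta(\alpha,S,\mathcal{U}) = \limsup_{n\to\infty} \frac{\log_2 (S^n:\mathcal{U})_{\alpha}}{n}$. *)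

(* Defs.v *)
From HB Require Import structures.
From mathcomp Require Import all_boot all_order all_algebra.
From mathcomp Require Import all_classical all_reals all_analysis.
From mathcomp Require Import measurable_realfun finmap complex ring.
From mathcomp Require Import generic_quotient ring_quotient.

Set Implicit Arguments.
Unset Strict Implicit.
Unset Printing Implicit Defensive.

Import Order.TTheory GRing.Theory Num.Theory.
Import numFieldNormedType.Exports.

Local Open Scope classical_set_scope.
Local Open Scope ring_scope.
Local Open Scope quotient_scope.

HB.mixin Record PreTopologicalGroup_isTopologicalGroup G
    of Topological G & Group G := {
  mulg_continuous : continuous (fun x : G * G => (x.1 * x.2)%g);
  invg_continuous : continuous (fun x : G => (x^-1)%g)
}.

#[short(type="topologicalGroupType")]
HB.structure Definition TopologicalGroup :=
  {G of Topological G & Group G & PreTopologicalGroup_isTopologicalGroup G}.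

Section generating.
Variable G : topologicalGroupType.
Implicit Types S : set G.

Definition setpow S (n : nat) : set G :=
  [set x | exists s : 'I_n -> G,
     (forall i, S (s i)) /\ x = (\prod_(i < n) s i)%g].

Definition generates S : Prop :=
  S 1%g /\ [set: G] = \bigcup_(n in [set n | (0 < n)%N]) setpow S n.

Definition compactly_generated : Prop :=
  exists S : set G, compact S /\ generates S.

End generating.

Arguments compactly_generated : clear implicits.

Section entropy.
Context {R : realType} {G : topologicalGroupType} {X : topologicalType}.
Variable alpha : G -> X -> X.
Implicit Types (S : set G) (U V : set (set X)).
Local Open Scope ereal_scope.

Definition finite_open_covering U : Prop :=
  [/\ finite_set U, forall A, U A -> open A & \bigcup_(A in U) A = [set: X]].

Definition covering_prec S U V : Prop :=
  forall g, S g -> forall B, V B -> exists2 A, U A & alpha g @` B `<=` A.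

(* The infimum is taken in the extended reals, where inf set0 = +oo. *)
Definition covering_number S U : \bar R :=
  ereal_inf [set (#|` fset_set V|%:R)%:E | V in
    [set V | finite_open_covering V /\ covering_prec S U V]].

Definition log2e (x : \bar R) : \bar R := lne x * ((ln 2)^-1)%:E.

Definition entropy S U : \bar R :=
  limn_esup (fun n => log2e (covering_number (setpow S n) U) * (n%:R^-1)%:E).

End entropy.

Section borel.
Variable G : topologicalGroupType.

Definition borel : Type := G.

HB.instance Definition _ := Choice.on borel.
HB.instance Definition _ := isPointed.Build borel (1%g : G).
HB.instance Definition _ :=
  Measurable.copy borel (g_sigma_algebraType (@open G : set (set borel))).

End borel.

Section haar.
Context {R : realType} {G : topologicalGroupType}.
Local Open Scope ereal_scope.

(* A nonzero left-invariant Radon measure on the Borel sets of G. *)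
Record left_haar (mu : {measure set (borel G) -> \bar R}) : Prop := {
  left_haar_neq0 : mu [set: G] != 0 ;
  left_haar_compact : forall C : set G, compact C -> mu C < +oo ;
  left_haar_outer : forall A : set (borel G), measurable A ->
    mu A = ereal_inf [set mu U | U in [set U : set G | open U /\ A `<=` U]] ;
  left_haar_inner : forall U : set G, open U ->
    mu U = ereal_sup [set mu C | C in [set C : set G | compact C /\ C `<=` U]] ;
  left_haar_invariant : forall (g : G) (A : set (borel G)), measurable A ->
    mu [set (g * x)%g | x in A] = mu A
}.

End haar.

Variant scalar_kind := RealScalars | ComplexScalars.

Definition scalars (R : realType) (k : scalar_kind) : numFieldType :=
  match k with RealScalars => R | ComplexScalars => R[i]%C end.

Definition scalar_re {R : realType} {k : scalar_kind} : scalars R k -> R :=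
  match k return scalars R k -> R with
  | RealScalars => id
  | ComplexScalars => @complex.Re R
  end.

Definition scalar_im {R : realType} {k : scalar_kind} : scalars R k -> R :=
  match k return scalars R k -> R with
  | RealScalars => cst 0
  | ComplexScalars => @complex.Im R
  end.

(* The norm of a numFieldType takes its values in the field itself, hence the
   real part. *)
Definition modulus {R : realType} {k : scalar_kind} (x : scalars R k) : R :=
  scalar_re `|x|.

Section scalars_theory.
Variables (R : realType) (k : scalar_kind).
Local Notation K := (scalars R k).
Implicit Types x y a : K.

Lemma scalar_reD x y : scalar_re (x + y) = scalar_re x + scalar_re y.
Proof. by case: k x y => //= -[? ?] [? ?]. Qed.

Lemma scalar_imD x y : scalar_im (x + y) = scalar_im x + scalar_im y.
Proof. by case: k x y => /= [x y|[? ?] [? ?]//]; rewrite /cst addr0. Qed.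

Lemma scalar_reM a x :
  scalar_re (a * x) = scalar_re a * scalar_re x - scalar_im a * scalar_im x.
Proof. by case: k a x => /= [x y|[? ?] [? ?]//]; rewrite /cst mulr0 subr0. Qed.

Lemma scalar_imM a x :
  scalar_im (a * x) = scalar_re a * scalar_im x + scalar_im a * scalar_re x.
Proof.
by case: k a x => /= [x y|[? ?] [? ?]//]; rewrite /cst mulr0 mul0r addr0.
Qed.

Lemma scalar_re0 : scalar_re (0 : K) = 0. Proof. by case: k. Qed.

Lemma scalar_im0 : scalar_im (0 : K) = 0. Proof. by case: k. Qed.

Lemma modulusE x :
  modulus x = Num.sqrt (scalar_re x ^+ 2 + scalar_im x ^+ 2).
Proof.
case: k x => /= [x|[a b]//]; rewrite /modulus /= /cst expr0n addr0.
by rewrite sqrtr_sqr.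
Qed.

Lemma modulus_ge0 x : 0 <= modulus x.
Proof. by rewrite modulusE sqrtr_ge0. Qed.

End scalars_theory.

Section L1.
Context {R : realType} {G : topologicalGroupType}.
Variables (k : scalar_kind) (mu : {measure set (borel G) -> \bar R}).
Local Notation K := (scalars R k).
Implicit Types f g : G -> K.

Definition L1fun : {pred G -> K} := [pred f | `[<
  mu.-integrable [set: borel G] (fun x => (scalar_re (f x))%:E) /\
  mu.-integrable [set: borel G] (fun x => (scalar_im (f x))%:E) >]].

Lemma L1fun_submod_closed : submod_closed (L1fun : {pred G -> K^o}).
Proof.
split.
  apply/asboolP; split.
    by under eq_fun do rewrite scalar_re0; exact: integrable0.
  by under eq_fun do rewrite scalar_im0; exact: integrable0.
move=> a f g /asboolP[fr fi] /asboolP[gr gi]; apply/asboolP; split.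
  under eq_fun do rewrite scalar_reD scalar_reM EFinD EFinB !EFinM.
  by apply: integrableD => //; apply: integrableB => //; exact: integrableZl.
under eq_fun do rewrite scalar_imD scalar_imM !EFinD !EFinM.
by apply: integrableD => //; apply: integrableD => //; exact: integrableZl.
Qed.

HB.instance Definition _ :=
  GRing.isSubmodClosed.Build K (G -> K^o) L1fun L1fun_submod_closed.

Record L1fun_type := MkL1fun {
  L1fun_val :> G -> K^o ; L1fun_valP : L1fun_val \in L1fun }.

HB.instance Definition _ := [isSub for L1fun_val].
HB.instance Definition _ := [Choice of L1fun_type by <:].
HB.instance Definition _ := [SubChoice_isSubLmodule of L1fun_type by <:].

Lemma L1fun_scaleE (a : K) (f : L1fun_type) x : (a *: f) x = a *: f x.
Proof. by []. Qed.

Definition L1null : {pred L1fun_type} :=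
  [pred f : L1fun_type | `[< {ae mu, forall x, f x = 0} >]].

Lemma L1null_zmod_closed : zmod_closed L1null.
Proof.
split; first by apply/asboolP; apply: aeW.
move=> f g /asboolP f0 /asboolP g0; apply/asboolP.
have FF : Filter (nbhs (almost_everywhere mu)).
  exact: ae_filter_ringOfSetsType.
apply: filterS2 f0 g0 => x fx gx.
by rewrite -[LHS]/(f x - g x) fx gx subrr.
Qed.

HB.instance Definition _ :=
  GRing.isZmodClosed.Build L1fun_type L1null L1null_zmod_closed.

Definition L1 : Type := Quotient.quot (L1null : zmodClosed L1fun_type).
HB.instance Definition _ := GRing.Zmodule.on L1.
HB.instance Definition _ := EqQuotient.on L1.

Lemma eq_piL1 (f g : L1fun_type) :
  {ae mu, forall x, f x = g x} <-> \pi_L1 f = \pi_L1 g.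
Proof.
split=> [fg|/eqP].
  apply/eqP; rewrite -Quotient.idealrBE; apply/asboolP.
  have FF : Filter (nbhs (almost_everywhere mu)).
    exact: ae_filter_ringOfSetsType.
  by apply: filterS fg => x fgx; rewrite -[LHS]/(f x - g x) fgx subrr.
rewrite -Quotient.idealrBE => /asboolP fg.
have FF : Filter (nbhs (almost_everywhere mu)).
  exact: ae_filter_ringOfSetsType.
apply: filterS fg => x /eqP.
by rewrite -[X in X == 0]/(f x - g x) subr_eq0 => /eqP.
Qed.

Lemma piL1D (f g : L1fun_type) : \pi_L1 (f + g) = \pi_L1 f + \pi_L1 g.
Proof. by rewrite !piE. Qed.

Definition L1_scale (a : K) (F : L1) : L1 := \pi_L1 (a *: repr F).

Lemma L1_scaleE a (f : L1fun_type) : L1_scale a (\pi_L1 f) = \pi_L1 (a *: f).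
Proof.
apply/eq_piL1; have /eq_piL1 := reprK (\pi_L1 f).
move: (repr _) => g fg; have FF : Filter (nbhs (almost_everywhere mu)).
  exact: ae_filter_ringOfSetsType.
by apply: filterS fg => x fx; rewrite !L1fun_scaleE fx.
Qed.

Lemma L1_scaleA a b F : L1_scale a (L1_scale b F) = L1_scale (a * b) F.
Proof. by rewrite -[F]reprK [L1_scale b _]L1_scaleE !L1_scaleE scalerA. Qed.

Lemma L1_scale1 F : L1_scale 1 F = F.
Proof. by rewrite -[F]reprK !L1_scaleE scale1r. Qed.

Lemma L1_scaleDr : right_distributive L1_scale +%R.
Proof.
move=> a F H; rewrite -[F]reprK -[H]reprK -piL1D !L1_scaleE scalerDr.
exact: piL1D.
Qed.

Lemma L1_scaleDl F : {morph L1_scale^~ F : a b / a + b}.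
Proof. by move=> a b; rewrite -[F]reprK !L1_scaleE scalerDl piL1D. Qed.

HB.instance Definition _ := GRing.Zmodule_isLmodule.Build K L1
  L1_scaleA L1_scale1 L1_scaleDr L1_scaleDl.

Definition L1norm (F : L1) : R := \int[mu]_x modulus ((repr F : G -> K) x).

Definition functional_norm (l : {linear L1 -> K^o}) : \bar R :=
  ereal_sup [set (modulus (l F : K))%:E | F in [set F | L1norm F <= 1]].

(* The closed unit ball of the dual: a linear functional of norm at most 1 is
   automatically bounded. *)
Record Binf := MkBinf {
  Binf_val :> {linear L1 -> K^o} ;
  Binf_norm : (functional_norm Binf_val <= 1)%E }.

HB.instance Definition _ := gen_eqMixin Binf.
HB.instance Definition _ := gen_choiceMixin Binf.
(* The weak-* topology: the initial topology for all evaluation maps. *)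
HB.instance Definition _ := Topological.copy Binf
  (sup_topology (fun F : L1 =>
    Topological.on (initial_topology (fun l : Binf => (l F : K^o))))).

End L1.

Arguments L1fun {R G} k mu.

Section L1_theory.
Context {R : realType} {G : topologicalGroupType} {k : scalar_kind}.
Context {mu : {measure set (borel G) -> \bar R}}.
Local Notation K := (scalars R k).

Lemma piL1Z a (f : L1fun_type k mu) :
  \pi_(L1 k mu) (a *: f) = a *: \pi_(L1 k mu) f.
Proof. by rewrite -L1_scaleE. Qed.

Lemma measurable_modulus (f : L1fun_type k mu) :
  measurable_fun [set: borel G] (fun x : borel G => modulus (f x : K)).
Proof.
have /asboolP[/integrableP[/measurable_EFinP fr _]] := L1fun_valP f.
move=> /integrableP[/measurable_EFinP fi _].
under eq_fun do rewrite modulusE.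
have ms : measurable_fun [set: R] (Num.sqrt : R -> R).
  by apply: continuous_measurable_fun; exact: sqrt_continuous.
apply: (measurableT_comp ms).
by apply: measurable_funD; exact: measurable_funX.
Qed.

Lemma L1norm_pi (f : L1fun_type k mu) :
  L1norm (\pi_(L1 k mu) f) = \int[mu]_x modulus (f x : K).
Proof.
have /eq_piL1 := reprK (\pi_(L1 k mu) f); rewrite /L1norm.
move: (repr _) => h hf; rewrite /Rintegral; congr fine.
apply: ge0_ae_eq_integral => //.
- by apply/measurable_EFinP; exact: measurable_modulus.
- by apply/measurable_EFinP; exact: measurable_modulus.
- by move=> x _; rewrite lee_fin modulus_ge0.
- by move=> x _; rewrite lee_fin modulus_ge0.
have FF : Filter (nbhs (almost_everywhere mu)).
  exact: ae_filter_ringOfSetsType.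
by apply: filterS hf => x -> _.
Qed.

End L1_theory.

Section canonical_action.
Context {R : realType} {G : topologicalGroupType} {k : scalar_kind}.
Context {mu : {measure set (borel G) -> \bar R}}.
Hypothesis haar : left_haar mu.
Local Notation K := (scalars R k).

Lemma mulg_continuousr (g : G) : continuous (fun x : G => (g * x)%g).
Proof.
move=> x; apply: (@continuous_comp G (G * G)%type G (pair g)
  (fun p => (p.1 * p.2)%g)); last exact: mulg_continuous.
by apply: cvg_pair; [exact: cvg_cst|exact: cvg_id].
Qed.

Definition ltrans (g : G) : borel G -> borel G := fun x => (g * x)%g.

Lemma measurable_ltrans g : measurable_fun [set: borel G] (ltrans g).
Proof.
apply: (@measurability _ _ (borel G) (borel G) setT (ltrans g) (@open G)) => //.
move=> _ [U oU <-].
rewrite setTI; apply: sub_sigma_algebra.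
by apply: (open_comp _ oU) => x _; exact: mulg_continuousr.
Qed.

HB.instance Definition _ g := isMeasurableFun.Build _ _ (borel G) (borel G)
  (ltrans g) (measurable_ltrans g).

Lemma ltrans_preimage g (A : set (borel G)) :
  ltrans g @^-1` A = [set (g^-1 * x)%g | x in A].
Proof.
apply/seteqP; split=> [x Ax|_ [x Ax <-]] /=.
  by exists (g * x)%g => //; rewrite mulKg.
by rewrite /ltrans/= mulVKg.
Qed.

Lemma ltrans_invariant g (A : set (borel G)) : measurable A ->
  mu (ltrans g @^-1` A) = mu A.
Proof. by move=> mA; rewrite ltrans_preimage left_haar_invariant. Qed.

Lemma integral_ltrans (g : G) (f : borel G -> \bar R) :
  measurable_fun [set: borel G] f -> (forall x, 0 <= f x)%E ->
  (\int[mu]_x f (ltrans g x) = \int[mu]_x f x)%E.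
Proof.
move=> mf f0.
pose nu : {measure set (borel G) -> \bar R} := pushforward mu (ltrans g).
transitivity (\int[nu (measurable_ltrans g)]_x f x)%E; last first.
  by apply: eq_measure_integral => A mA _; exact: ltrans_invariant.
by rewrite (ge0_integral_pushforward (measurable_ltrans g)) ?preimage_setT.
Qed.

Lemma integrable_ltrans (g : G) (f : borel G -> \bar R) :
  mu.-integrable [set: borel G] f ->
  mu.-integrable [set: borel G] (fun x : borel G => f (ltrans g x)).
Proof.
move=> /integrableP[mf fI]; apply/integrableP; split.
  exact: (measurableT_comp mf (measurable_ltrans g)).
rewrite (@integral_ltrans g (fun x => `|f x|)%E)//.
exact: measurableT_comp.
Qed.

Lemma L1fun_ltrans g (f : L1fun_type k mu) :
  (fun x => f (ltrans g x)) \in L1fun k mu.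
Proof.
have /asboolP[fr fi] := L1fun_valP f; apply/asboolP; split.
  exact: (@integrable_ltrans g (fun x => (scalar_re (f x : K))%:E)).
exact: (@integrable_ltrans g (fun x => (scalar_im (f x : K))%:E)).
Qed.

Definition L1fun_shift g (f : L1fun_type k mu) : L1fun_type k mu :=
  MkL1fun (L1fun_ltrans g f).

Lemma ae_ltrans g (P : borel G -> Prop) :
  {ae mu, forall x, P x} -> {ae mu, forall x, P (ltrans g x)}.
Proof.
move=> [A [mA A0 PA]]; exists (ltrans g @^-1` A); split.
- by rewrite -[X in measurable X]setTI; exact: measurable_ltrans.
- by rewrite ltrans_invariant.
- by move=> x /= Px; apply: PA.
Qed.

Definition L1_shift g (F : L1 k mu) : L1 k mu :=
  \pi_(L1 k mu) (L1fun_shift g (repr F)).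

Lemma L1_shiftE g (f : L1fun_type k mu) :
  L1_shift g (\pi_(L1 k mu) f) = \pi_(L1 k mu) (L1fun_shift g f).
Proof.
have /eq_piL1 := reprK (\pi_(L1 k mu) f); rewrite /L1_shift.
move: (repr _) => h hf; apply/eq_piL1.
exact: (@ae_ltrans g (fun x => h x = f x)).
Qed.

Lemma L1_shift_linear g : linear (L1_shift g).
Proof.
move=> a F H; rewrite -[F]reprK -[H]reprK; move: (repr F) (repr H) => f h.
rewrite -piL1Z -piL1D !L1_shiftE -piL1Z -piL1D; congr (\pi _).
exact: val_inj.
Qed.

Lemma L1norm_shift g F : L1norm (L1_shift g F) = L1norm F.
Proof.
rewrite -[F]reprK; move: (repr F) => f.
rewrite L1_shiftE !L1norm_pi /Rintegral; congr fine.
apply: (@integral_ltrans g (fun x => (modulus (f x : K))%:E)).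
  by apply/measurable_EFinP; exact: measurable_modulus.
by move=> x; rewrite lee_fin modulus_ge0.
Qed.

Section action.
Variables (g : G) (l : Binf k mu).

Definition shift_functional (F : L1 k mu) : K^o := l (L1_shift g F).

Lemma shift_functional_linear : linear shift_functional.
Proof. by move=> a F H; rewrite /shift_functional L1_shift_linear linearP. Qed.

HB.instance Definition _ :=
  GRing.isLinear.Build K (L1 k mu) K^o _ shift_functional shift_functional_linear.

Lemma shift_functional_norm : (functional_norm shift_functional <= 1)%E.
Proof.
apply: le_trans (Binf_norm l); apply: ereal_sup_le => _ [F F1 <-].
by exists (L1_shift g F) => //=; rewrite L1norm_shift.
Qed.

Definition canonical_action : Binf k mu := MkBinf shift_functional_norm.

End action.

End canonical_action.

(* Main.v *)
Require Import Defs.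
From HB Require Import structures.
From mathcomp Require Import all_boot all_order all_algebra.
From mathcomp Require Import all_classical all_reals all_analysis.
From mathcomp Require Import finmap measurable_realfun complex generic_quotient.
From mathcomp Require Import zify ring lra.

(* By the Baire category theorem some power S^k is an identity neighborhood.
   If G is not compact then S^(n + k) is never contained in S^n, so one can pick
   g_i in S^(k(2i + 2)) outside S^(k(2i + 1)) for i < m; then g_i g_j^-1 is not
   in S^k for j < i.  For an open W around 1 with W W^-1 inside S^k, the
   translates g_i^-1 W are therefore pairwise disjoint.  Let f be the indicator
   function of W and c = mu W > 0; the covering consists of the two open sets
   {l | l f <> c} and {l | l f <> - c}.  Integrating against a signed sum of the
   indicator functions of the g_i^-1 W realizes all 2^m sign patterns of
   (alpha(g_i, l) f)_(i < m) in the unit ball, and functionals with different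
   patterns cannot share a member of an admissible covering.  Hence
   (S^(2km) : V) >= 2^m. *)

Set Implicit Arguments.
Unset Strict Implicit.
Unset Printing Implicit Defensive.

Import Order.TTheory GRing.Theory Num.Theory.
Import numFieldNormedType.Exports.

Local Open Scope classical_set_scope.
Local Open Scope ring_scope.
Local Open Scope quotient_scope.

(** * Baire category in locally compact Hausdorff spaces *)

(** Otherwise there are nonempty open sets [O n] with the closure of [O n.+1] inside [O n] minus
    [A n]; compactness gives a point common to all these closures, and it lies in no [A n]. *)
Lemma locally_compact_baire (T : topologicalType) (A : nat -> set T) :
  hausdorff_space T -> locally_compact [set: T] -> [set: T] !=set0 ->
  (forall n, closed (A n)) -> \bigcup_n A n = setT ->
  exists n, (A n)° !=set0.
Proof.
move=> hT lcT [x0 _] clA covA; apply: contrapT => noint.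
have cnbhs (x : T) : exists2 B : set T, compact B & nbhs x B.
  have [B + [cB _]] := lcT x I; exists B => //.
  by rewrite -[nbhs x]withinET.
have regT (x : T) O : nbhs x O ->
    exists2 B : set T, nbhs x B & closure B `<=` O.
  have [B cB xB] := cnbhs x.
  by move=> xO; exact: (compact_regular hT cB).
(* The conditions on [p.2] stand inside the existential, so that [choice] yields a function on all
   pairs. *)
have step (p : nat * set T) : exists O', open p.2 -> p.2 !=set0 ->
    [/\ open O', O' !=set0 & closure O' `<=` p.2 `\` A p.1].
  case: p => n O /=.
  have [[oO [y Oy]]|nO] := pselect (open O /\ O !=set0); last first.
    by exists set0 => oO O0; case: nO.
  have [x [Ox nAx]] : O `\` A n !=set0.
    apply/set0P/eqP => OA; apply: noint; exists n; exists y.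
    apply: (@filterS _ _ _ O); last exact: open_nbhs_nbhs.
    by rewrite -setD_eq0.
  have : nbhs x (O `\` A n).
    apply: open_nbhs_nbhs; split => //; apply: openI => //.
    exact: closed_openC.
  move=> /regT[B xB BO]; exists B° => _ _; split.
  - exact: open_interior.
  - by exists x; exact: nbhs_singleton (nbhs_interior xB).
  - by apply: subset_trans BO; apply: closureS; exact: interior_subset.
have [f fP] := choice step.
have [B cB xB] := cnbhs x0.
pose O := fix O n := if n is n'.+1 then f (n', O n') else B°.
have OP n : open (O n) /\ O n !=set0.
  elim: n => [|n [oO O0]] /=; last by have [] := fP (n, O n) oO O0.
  split; first exact: open_interior.
  by exists x0; exact: nbhs_singleton (nbhs_interior xB).
have OS n : closure (O n.+1) `<=` O n `\` A n.
  by have [oO O0] := OP n; have [] := fP (n, O n) oO O0.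
have Omono m n : (m <= n)%N -> O n `<=` O m.
  elim: n => [|n IH]; first by rewrite leqn0 => /eqP ->.
  rewrite leq_eqVlt => /predU1P[->//|/IH]; apply: subset_trans.
  by move=> x /subset_closure/OS[].
pose F := filter_from [set: nat] O.
have FF : ProperFilter F.
  apply: filter_from_proper => [|n _]; last by case: (OP n).
  apply: filter_from_filter => [|m n _ _]; first by exists 0%N.
  exists (maxn m n) => // x Ox.
  by split; apply: Omono Ox; rewrite ?leq_maxl ?leq_maxr.
have FB : F B by exists 0%N => //; exact: interior_subset.
have [p [_ pF]] := cB F FF FB.
have : (\bigcup_n A n) p by rewrite covA.
move=> [n _ Anp].
have /OS[] // : closure (O n.+1) p.
by move=> C pC; apply: pF => //; exists n.+1.
Qed.

(** * Powers of a generating set *)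

Section setpow_theory.
Variable G : topologicalGroupType.
Implicit Types S : set G.

Lemma setpow0 S : setpow S 0 = [set 1%g].
Proof.
apply/seteqP; split=> [x [s [_ ->]]|x ->]; first by rewrite big_ord0.
by exists (fun=> 1%g); split=> [[]//|]; rewrite big_ord0.
Qed.

Lemma setpowS S n :
  setpow S n.+1 = (fun p : G * G => p.1 * p.2)%g @` (setpow S n `*` S).
Proof.
apply/seteqP; split=> [x [s [Ss ->]]|_ [[x y] /= [[s [Ss ->]] Sy] <-]].
  exists ((\prod_(i < n) s (widen_ord (leqnSn n) i))%g, s ord_max).
    by split=> //=; exists (fun i => s (widen_ord (leqnSn n) i)).
  by rewrite big_ord_recr.
exists (fun i => if unlift ord_max i is Some j then s j else y); split.
  by move=> i; case: unliftP.
rewrite big_ord_recr /= unlift_none; congr (_ * _)%g.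
apply: eq_bigr => i _.
have -> : widen_ord (leqnSn n) i = lift ord_max i.
  by apply/val_inj => /=; rewrite /bump leqNgt ltn_ord.
by rewrite liftK.
Qed.

Lemma setpowM S m n x y :
  setpow S m x -> setpow S n y -> setpow S (m + n) (x * y)%g.
Proof.
move=> Sx; elim: n y => [|n IH] y.
  by rewrite setpow0 addn0 => ->; rewrite mulg1.
rewrite addnS !setpowS => -[[u v] /= [Su Sv] <-].
by exists ((x * u)%g, v) => /=; [split => //; exact: IH|rewrite mulgA].
Qed.

Lemma setpow_mono S m n : S 1%g -> (m <= n)%N -> setpow S m `<=` setpow S n.
Proof.
move=> S1 /subnKC <- x Sx; rewrite -[x]mulg1; apply: setpowM => //.
elim: (n - m)%N => [|p IH]; first by rewrite setpow0.
by rewrite setpowS; exists (1, 1)%g => //=; rewrite mulg1.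
Qed.

Lemma compact_setpow S n : compact S -> compact (setpow S n).
Proof.
move=> cS; elim: n => [|n IH]; first by rewrite setpow0; exact: compact_set1.
rewrite setpowS; apply: continuous_compact; last exact: compact_setX.
by apply: continuous_subspaceT; exact: mulg_continuous.
Qed.

Lemma generates_setpow S x : generates S -> exists n, setpow S n x.
Proof.
move=> [_ SG]; have : [set: G] x by [].
by rewrite SG => -[n _ Snx]; exists n.
Qed.

(** By Baire some S^n has an interior point x; translating by x^-1, which lies in some S^m, makes
    S^(m + n) an identity neighborhood. *)
Lemma setpow_nbhs1 S : hausdorff_space G -> locally_compact [set: G] ->
  compact S -> generates S ->
  exists n, (0 < n)%N /\ nbhs (1%g : G) (setpow S n).
Proof.
move=> hG lcG cS gS; have S1 := gS.1.
have [|||n [x xSn]] := @locally_compact_baire G (setpow S) hG lcG.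
- by exists 1%g.
- by move=> n; apply: compact_closed => //; exact: compact_setpow.
- by apply/seteqP; split=> // x _; have [n] := generates_setpow x gS; exists n.
have [m Smx] := generates_setpow (x^-1)%g gS.
(* The successor keeps the exponent positive even if m = n = 0. *)
exists (m + n).+1; split => //.
have : nbhs (1%g : G) ((fun y : G => (x * y)%g) @^-1` setpow S n).
  have /(_ (setpow S n)) := @mulg_continuousr G x 1%g.
  by apply; rewrite mulg1.
apply: filterS => y /= Sxy; apply: (@setpow_mono S (m + n)) => //.
by rewrite -(mulKg x y); exact: setpowM.
Qed.

(** Otherwise S^(n + 1) is inside S^n, by induction so is every power, and G = S^n would be
    compact. *)
Lemma setpow_proper S k n : compact S -> generates S -> ~ compact [set: G] ->
  (0 < k)%N -> setpow S (n + k) `\` setpow S n !=set0.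
Proof.
move=> cS gS ncG k0; apply/set0P/eqP; rewrite setD_eq0 => sub; have S1 := gS.1.
apply: ncG; suff -> : setT = setpow S n by exact: compact_setpow.
apply/seteqP; split=> // x _; have [p Spx] := generates_setpow x gS.
suff H q : setpow S (n + q) `<=` setpow S n.
  by apply: (H p); apply: setpow_mono Spx => //; exact: leq_addl.
elim: q => [|q IH]; first by rewrite addn0.
rewrite addnS setpowS => _ [[u v] /= [/IH Su Sv] <-].
apply: sub; apply: (@setpow_mono S n.+1) => //; first by lia.
by rewrite setpowS; exists (u, v).
Qed.

Lemma setpow_separated S k m : compact S -> generates S ->
  ~ compact [set: G] -> (0 < k)%N ->
  exists g : 'I_m -> G, (forall i, setpow S (2 * k * m) (g i)) /\
    forall i j : 'I_m, (j < i)%N -> ~ setpow S k (g i / g j)%g.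
Proof.
move=> cS gS ncG k0; have S1 := gS.1.
have /choice[g gP] (i : 'I_m) : exists x, setpow S (2 * k * i + k + k) x /\
    ~ setpow S (2 * k * i + k) x.
  by have [x []] := setpow_proper (2 * k * i + k) cS gS ncG k0; exists x.
exists g; split=> [i|i j ji Sij].
  have [Si _] := gP i; apply: setpow_mono Si => //.
  by have := ltn_ord i; nia.
(* Writing [g i] as [g i / g j] times [g j] would put it into the power 2kj + 3k <= 2ki + k, which
   [g i] was chosen to avoid. *)
have [_] := gP i; apply; have [Sj _] := gP j.
rewrite -(mulgVK (g j) (g i)).
by apply: setpow_mono (setpowM Sij Sj) => //; nia.
Qed.

End setpow_theory.

(** * Lower bounds for covering numbers and entropy *)

Section covering.
Context {R : realType} {G : topologicalGroupType} {X : topologicalType}.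
Variable alpha : G -> X -> X.

(** For each pattern pick a covering member [A s] around its point. If patterns that differ at i
    shared a member, its image under [g i] would lie in some [U b]; but b is one of the two values
    at i, and the corresponding point avoids [U b]. *)
Lemma covering_number_ge (m : nat) (S : set G) (g : 'I_m -> G)
    (U : bool -> set X) : (forall i, S (g i)) ->
  (forall s : {ffun 'I_m -> bool}, exists x, forall i,
     ~ U (s i) (alpha (g i) x)) ->
  (((2 ^+ m)%:E : \bar R) <= covering_number alpha S [set U b | b in setT])%E.
Proof.
move=> Sg /choice[p pU].
apply: le_ereal_inf_tmp => _ [V [[finV _ covV] prec] <-].
rewrite lee_fin -natrX ler_nat.
have /choice[A AP] (s : {ffun 'I_m -> bool}) : exists A, V A /\ A (p s).
  have : [set: X] (p s) by [].
  by rewrite -covV => -[A VA Ap]; exists A.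
have Ainj : injective A.
  move=> s t st; apply/ffunP => i; apply/eqP; apply: contrapT => /negP sti.
  have [Vs As] := AP s; have [_ At] := AP t.
  have [_ [b _ <-] sub] := prec _ (Sg i) _ Vs.
  have [bs|bt] : b = s i \/ b = t i.
    by move: sti {sub}; case: b; case: (s i); case: (t i) => //=; auto.
  - by apply: (pU s i); rewrite -bs; apply: sub; exists (p s).
  - by apply: (pU t i); rewrite -bt; apply: sub; exists (p t) => //; rewrite st.
have <- : #|` [fset A s | s in {ffun 'I_m -> bool}]%fset| = (2 ^ m)%N.
  by rewrite card_imfset // -cardE card_ffun card_bool card_ord.
apply: fsubset_leq_card; apply/fsubsetP => _ /imfsetP[s _ ->].
by rewrite in_fset_set //; apply/mem_set; have [] := AP s.
Qed.

(** Along the multiples of k the quotients are at least m / (k m) = 1/k, which bounds the limsup. *)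
Lemma entropy_ge (k : nat) (S : set G) (U : set (set X)) : (0 < k)%N ->
  (forall m, (((2 ^+ m)%:E : \bar R) <=
              covering_number alpha (setpow S (k * m)) U)%E) ->
  ((k%:R^-1)%:E <= entropy (R := R) alpha S U)%E.
Proof.
move=> k0 cov; apply: le_ereal_inf_tmp => _ [B [N _ NB] <-].
have k0R : (0 : R) < k%:R by rewrite ltr0n.
apply: ereal_sup_ge.
(* [B] contains all indices from [N] on; [N.+1] keeps the index nonzero, so that the quotient
   cancels to 1/k. *)
exists (log2e (covering_number (R := R) alpha (setpow S (k * N.+1)) U) *
   ((k * N.+1)%N%:R^-1)%:E)%E.
  by exists (k * N.+1)%N => //; apply: NB => /=; nia.
have ln2 : (0 : R) < ln 2 by rewrite ln_gt0 // ltr1n.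
have : ((N.+1%:R)%:E <=
    log2e (covering_number (R := R) alpha (setpow S (k * N.+1)) U))%E.
  apply: (@le_trans _ _ (log2e ((2 ^+ N.+1)%:E : \bar R))).
    rewrite /log2e lne_EFin ?exprn_gt0 // lnXn // -EFinM -(mulr_natl (ln 2)).
    by rewrite mulfK // gt_eqF.
  apply: lee_wpmul2r; first by rewrite lee_fin invr_ge0 ltW.
  have pow0 : (0%:E <= (2 ^+ N.+1)%:E :> \bar R)%E by rewrite lee_fin exprn_ge0.
  rewrite lee_lne ?cov // in_itv /= leey andbT //.
  exact: le_trans (cov _).
move=> /(lee_wpmul2r _) H.
apply: le_trans (H ((k * N.+1)%N%:R^-1)%:E _); last first.
  by rewrite lee_fin invr_ge0 ler0n.
by rewrite -EFinM lee_fin natrM invfM mulrCA mulfV ?mulr1 // pnatr_eq0.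
Qed.

End covering.

(** * Haar measure of open sets *)

Section haar_theory.
Context {R : realType} {G : topologicalGroupType}.
Hypothesis hausdorffG : hausdorff_space G.
Variables (mu : {measure set (borel G) -> \bar R}) (haar : left_haar mu).
Local Open Scope ereal_scope.

Lemma borel_open (W : set G) : open W -> measurable (W : set (borel G)).
Proof. by move=> oW; exact: sub_sigma_algebra. Qed.

Lemma borel_compact (C : set G) : compact C -> measurable (C : set (borel G)).
Proof.
move=> /(compact_closed hausdorffG)/closed_openC/borel_open/measurableC.
by rewrite setCK.
Qed.

(** If W were null, its translates would give every point a null neighborhood, so compact sets would
    be null, and by inner regularity [mu] would vanish. *)
Lemma left_haar_open_gt0 (W : set G) : open W -> W 1%g -> 0 < mu W.
Proof.
move=> oW W1; rewrite lt0e measure_ge0 andbT; apply/eqP => muW0.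
have /negP := left_haar_neq0 haar; apply.
rewrite -measure_le0 [leLHS](left_haar_inner haar openT).
apply: ge_ereal_sup.
move=> _ [C [cC _] <-].
(* Negligibility also makes sense for nonmeasurable sets, over which the filter below ranges. *)
suff [N [mN muN CN]] : mu.-negligible C.
  rewrite -muN; apply: le_measure => //; apply/mem_set => //.
  exact: borel_compact.
apply: contrapT => nC.
(* The sets that are conull in C form a proper filter, whose cluster point in C
   has no null neighborhood. *)
pose F : set_system G := [set A | mu.-negligible (C `\` A)].
have FF : ProperFilter F.
  split; first by rewrite /F /= setD0.
  split.
  - by rewrite /F /= setDT; exact: (@negligible_set0 _ (borel G) _ mu).
  - by move=> A B FA FB; rewrite /F /= setDIr; exact: (@negligibleU _ (borel G)).
  - by move=> A B AB; apply: (@negligibleS _ (borel G)); exact: setDS.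
have FC : F C by rewrite /F /= setDv; exact: (@negligible_set0 _ (borel G) _ mu).
have [p [_ pF]] := cC F FF FC.
(* The left translate of W by p: null by invariance, and a neighborhood of p. *)
pose pW := ltrans p^-1%g @^-1` W.
have opW : open pW by apply: (open_comp _ oW) => x _; exact: mulg_continuousr.
have [||x [/= nx /nx//]] := pF (~` pW) pW.
  apply: (@negligibleS _ _ _ _ pW); first by rewrite setDE setCK => x [].
  exists pW; split => //; first exact: borel_open.
  by rewrite [LHS](ltrans_invariant haar) //; exact: borel_open.
apply: open_nbhs_nbhs; split => //.
by rewrite /pW /= /ltrans mulVg.
Qed.

End haar_theory.

(** * Functionals given by integration against a bounded function *)

Section integration_functional.
Context {R : realType} {G : topologicalGroupType} {k : scalar_kind}.
Context {mu : {measure set (borel G) -> \bar R}}.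
Local Notation K := (scalars R k).

Definition scalar_of (a b : R) : scalars R k :=
  match k return scalars R k with
  | RealScalars => a
  | ComplexScalars => (a +i* b)%C
  end.

Lemma re_scalar_of a b : scalar_re (scalar_of a b) = a.
Proof. by rewrite /scalar_of; case: k. Qed.

Lemma im_scalar_of0 a : scalar_im (scalar_of a 0) = 0.
Proof. by rewrite /scalar_of; case: k. Qed.

(** Lets linearity over K be checked on real and imaginary parts; for real scalars it holds because
    [scalar_im x] is 0. *)
Lemma scalar_of_linear (x : K) a b c d :
  scalar_of (scalar_re x * a - scalar_im x * b + c)
            (scalar_re x * b + scalar_im x * a + d) =
  x * scalar_of a b + scalar_of c d.
Proof.
rewrite /scalar_of; move: x; case: k => /= [x|[u v]//].
by rewrite /cst mul0r subr0.
Qed.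

Variable phi : borel G -> R.
Hypothesis mphi : measurable_fun [set: borel G] phi.
Hypothesis phi1 : forall x, `|phi x| <= 1.
Implicit Types f g : L1fun_type k mu.

Let integrable_phi (u : borel G -> R) :
  mu.-integrable [set: borel G] (EFin \o u) ->
  mu.-integrable [set: borel G] (EFin \o (fun x => phi x * u x)).
Proof.
move=> iu; apply: (le_integrable measurableT _ _ iu) => [|x _ /=].
  apply/measurable_EFinP; apply: measurable_funM => //.
  by apply/measurable_EFinP; exact: measurable_int iu.
by rewrite lee_fin normrM ler_piMl.
Qed.

Let integrable_re f :
  mu.-integrable [set: borel G] (EFin \o (fun x => scalar_re (f x : K))).
Proof. by have /asboolP[] := L1fun_valP f. Qed.

Let integrable_im f :
  mu.-integrable [set: borel G] (EFin \o (fun x => scalar_im (f x : K))).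
Proof. by have /asboolP[] := L1fun_valP f. Qed.

(** The K-valued integral of phi f; it splits into components because phi is real. *)
Definition integral_against f : K :=
  scalar_of (\int[mu]_x (phi x * scalar_re (f x : K)))
            (\int[mu]_x (phi x * scalar_im (f x : K))).

(** The three-term shape is that of the real and imaginary parts of [a *: f + g]; with w = 0 it also
    serves the norm estimate. *)
Let Rintegral_phi_linear (a b : R) (u v w : borel G -> R) :
  mu.-integrable [set: borel G] (EFin \o u) ->
  mu.-integrable [set: borel G] (EFin \o v) ->
  mu.-integrable [set: borel G] (EFin \o w) ->
  \int[mu]_x (phi x * (a * u x + b * v x + w x)) =
  a * (\int[mu]_x (phi x * u x)) + b * (\int[mu]_x (phi x * v x)) +
  \int[mu]_x (phi x * w x).
Proof.
move=> /integrable_phi iu /integrable_phi iv /integrable_phi iw.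
have iau := integrableZl measurableT a iu.
have ibv := integrableZl measurableT b iv.
have iab : mu.-integrable [set: borel G]
    (EFin \o (fun x => a * (phi x * u x) + b * (phi x * v x))).
  exact: (integrableD measurableT iau ibv).
rewrite -!RintegralZl // -!RintegralD //.
by apply: eq_Rintegral => x _; ring.
Qed.

Lemma integral_against_linear (a : K) f g :
  integral_against (a *: f + g) = a * integral_against f + integral_against g.
Proof.
rewrite -scalar_of_linear /integral_against -mulNr; congr scalar_of.
  rewrite -Rintegral_phi_linear //; apply: eq_Rintegral => x _.
  by rewrite scalar_reD scalar_reM mulNr.
rewrite -Rintegral_phi_linear //; apply: eq_Rintegral => x _.
by rewrite scalar_imD scalar_imM.
Qed.

Lemma eq_integral_against f g :
  {ae mu, forall x, f x = g x} -> integral_against f = integral_against g.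
Proof.
move=> fg; have FF : Filter (nbhs (almost_everywhere mu)).
  exact: ae_filter_ringOfSetsType.
have ae_int (p : K -> R) :
    (forall h : L1fun_type k mu,
      mu.-integrable [set: borel G] (EFin \o (fun x => p (h x : K)))) ->
    \int[mu]_x (phi x * p (f x : K)) = \int[mu]_x (phi x * p (g x : K)).
  move=> ip; congr fine; apply: ae_eq_integral => //.
  - exact: (measurable_int mu (integrable_phi (ip f))).
  - exact: (measurable_int mu (integrable_phi (ip g))).
  - by apply: filterS fg => x -> _.
by congr scalar_of; apply: ae_int.
Qed.

Lemma re_integral_against f :
  scalar_re (integral_against f) = \int[mu]_x (phi x * scalar_re (f x : K)).
Proof. exact: re_scalar_of. Qed.

(** For real scalars [scalar_of] forgets the second integral, but its integrand is then zero. *)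
Let im_integral_against f :
  scalar_im (integral_against f) = \int[mu]_x (phi x * scalar_im (f x : K)).
Proof.
rewrite /integral_against /scalar_of; move: f; case: k => [|//] f /=.
rewrite (@eq_Rintegral _ _ _ mu _ (cst 0)); last first.
  by move=> x _; rewrite /cst mulr0.
by rewrite Rintegral_cst // mul0r.
Qed.

Let integrable_modulus f :
  mu.-integrable [set: borel G] (EFin \o (fun x => modulus (f x : K))).
Proof.
have ia := integrableD measurableT (integrable_abse (integrable_re f))
  (integrable_abse (integrable_im f)).
apply: (le_integrable measurableT _ _ ia) => [|x _ /=].
  by apply/measurable_EFinP; exact: measurable_modulus.
rewrite lee_fin (ger0_norm (modulus_ge0 _)) ger0_norm ?addr_ge0 //.
rewrite modulusE -[leRHS]ger0_norm ?addr_ge0 // -sqrtr_sqr ler_sqrt ?sqr_ge0 //.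
by rewrite sqrrD !real_normK ?num_real // lerD2r lerDl mulrn_wge0 ?mulr_ge0.
Qed.

(* Cauchy-Schwarz in the plane: [a u + b v <= |a + ib| |u + iv|]. *)
Lemma modulus_integral_against f :
  modulus (integral_against f) <= \int[mu]_x modulus (f x : K).
Proof.
set z := integral_against f; set r := modulus z.
have rE : r ^+ 2 = scalar_re z ^+ 2 + scalar_im z ^+ 2.
  by rewrite /r modulusE sqr_sqrtr // addr_ge0 ?sqr_ge0.
have [->|r0] := eqVneq r 0.
  by apply: Rintegral_ge0 => x _; exact: modulus_ge0.
have {}r0 : 0 < r by rewrite lt_def r0 modulus_ge0.
(* After multiplication by r the left side r^2 is the integral of phi (Re z Re f + Im z Im f), so a
   pointwise bound by r |f| suffices. *)
rewrite -(ler_pM2l r0) -expr2 rE !expr2 -RintegralZl //.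
rewrite {1}re_integral_against {1}im_integral_against.
have i0 : mu.-integrable [set: borel G] (EFin \o cst 0) by exact: integrable0.
have := Rintegral_phi_linear (scalar_re z) (scalar_im z) (integrable_re f)
  (integrable_im f) i0.
rewrite -re_integral_against -im_integral_against -/z.
rewrite (@eq_Rintegral _ _ _ mu _ (cst 0) (fun x => phi x * cst 0 x)); last first.
  by move=> x _; rewrite /cst mulr0.
rewrite Rintegral_cst // mul0r addr0 => <-.
apply: le_Rintegral => //.
- apply: integrable_phi.
  have ia := integrableZl measurableT (scalar_re z) (integrable_re f).
  have ib := integrableZl measurableT (scalar_im z) (integrable_im f).
  exact: (integrableD measurableT (integrableD measurableT ia ib) i0).
- exact: (integrableZl measurableT r (integrable_modulus f)).
move=> x _; rewrite /cst addr0; apply: le_trans (ler_norm _) _.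
rewrite normrM; apply: le_trans (ler_piMl _ _) _ => //.
rewrite /r !modulusE -sqrtrM ?addr_ge0 ?sqr_ge0 //.
rewrite -sqrtr_sqr ler_sqrt; last first.
  by rewrite mulr_ge0 // addr_ge0 ?sqr_ge0.
set a := scalar_re z; set b := scalar_im z; set u := scalar_re _.
set v := scalar_im _; rewrite -subr_ge0.
(* Lagrange's identity in dimension two. *)
by rewrite (_ : _ - _ = (a * v - b * u) ^+ 2) ?sqr_ge0 //; ring.
Qed.

Definition integral_functional (F : L1 k mu) : K^o := integral_against (repr F).

Lemma integral_functional_pi f :
  integral_functional (\pi_(L1 k mu) f) = integral_against f.
Proof. by apply: eq_integral_against; apply/eq_piL1; rewrite reprK. Qed.

Lemma integral_functional_linear : linear integral_functional.
Proof.
move=> a F H; rewrite -[F]reprK -[H]reprK; move: (repr F) (repr H) => f h.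
by rewrite -piL1Z -piL1D !integral_functional_pi integral_against_linear.
Qed.

HB.instance Definition _ := GRing.isLinear.Build K (L1 k mu) K^o _
  integral_functional integral_functional_linear.

Lemma integral_functional_norm : (functional_norm integral_functional <= 1)%E.
Proof.
apply: ge_ereal_sup => _ [F F1 <-]; rewrite lee_fin.
exact: le_trans (modulus_integral_against _) F1.
Qed.

Definition Binf_integral : Binf k mu := MkBinf integral_functional_norm.

End integration_functional.

(** * Evaluation maps and sign patterns on the unit ball *)

Section evaluation.
Context {R : realType} {G : topologicalGroupType} {k : scalar_kind}.
Context {mu : {measure set (borel G) -> \bar R}}.
Local Notation K := (scalars R k).

Lemma Binf_eval_continuous (F : L1 k mu) :
  continuous (fun l : Binf k mu => (l F : K^o)).
Proof.
move=> l.
have /cvg_sup/(_ F) lF : nbhs l --> l by [].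
have cF := @initial_continuous _ _ (fun l : Binf k mu => (l F : K^o)).
by move=> A /(cF l) A'; exact: (lF _ A').
Qed.

(** These sets will be the members of the covering; points of K are closed and evaluation is weak-*
    continuous. *)
Lemma open_Binf_eval_neq (F : L1 k mu) (v : K^o) :
  open [set l : Binf k mu | (l F : K^o) <> v].
Proof.
apply: (@open_comp _ _ (fun l : Binf k mu => (l F : K^o)) (~` [set v])).
  by move=> l _; exact: Binf_eval_continuous.
apply: closed_openC; apply: accessible_closed_set1.
exact/hausdorff_accessible/norm_hausdorff.
Qed.

Section indicator.
Variable W : set (borel G).
Hypotheses (mW : measurable W) (muW : (mu W < +oo)%E).

Lemma integrable_indic_fin :
  mu.-integrable [set: borel G] (fun x => (\1_W x)%:E).
Proof.
apply/integrableP; split; first exact/measurable_EFinP.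
rewrite (eq_integral (fun x => (\1_W x)%:E)); last first.
  by move=> t _; rewrite gee0_abs// lee_fin.
by rewrite integral_indic// setIT.
Qed.

Lemma L1fun_indic : (fun x => scalar_of (\1_W x) 0) \in L1fun k mu.
Proof.
apply/asboolP; split.
  by under eq_fun do rewrite re_scalar_of; exact: integrable_indic_fin.
by under eq_fun do rewrite im_scalar_of0; exact: integrable0.
Qed.

Definition L1_indic : L1 k mu := \pi_(L1 k mu) (MkL1fun L1fun_indic).

Hypothesis haar : left_haar mu.
Variables (m : nat) (g : 'I_m -> G).
Hypothesis disjW : forall i j x, W (g i * x)%g -> W (g j * x)%g -> i = j.

(** Integrate against the signed sum phi of the indicators of the sets g_i^-1 W. Their disjointness
    gives |phi| <= 1 and leaves only the i-th sign on g_i^-1 W, whose measure is [mu W] by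
    invariance. *)
Lemma Binf_separate (s : 'I_m -> bool) : exists l : Binf k mu, forall i,
  canonical_action haar (g i) l L1_indic =
  scalar_of ((-1) ^+ s i * fine (mu W)) 0.
Proof.
pose h i x : R := \1_W (ltrans (g i) x).
have mh i : measurable_fun [set: borel G] (h i).
  have mI : measurable_fun setT (\1_W : borel G -> R).
    exact: measurable_indic.
  exact: (measurableT_comp mI (measurable_ltrans (g i))).
have h0 i j x : i != j -> h i x * h j x = 0.
  rewrite /h !indicE.
  have [/set_mem Wi|_] := boolP (ltrans (g i) x \in W); last by rewrite mul0r.
  have [/set_mem Wj|_] := boolP (ltrans (g j) x \in W); last by rewrite mulr0.
  by rewrite (disjW Wi Wj) eqxx.
have hh i x : h i x * h i x = h i x.
  by rewrite /h indicE; case: (_ \in W); rewrite ?mul1r ?mul0r.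
pose phi x := \sum_i (-1) ^+ s i * h i x.
have phih i x : phi x * h i x = (-1) ^+ s i * h i x.
  rewrite /phi mulr_suml (bigD1 i) //= -mulrA hh big1 ?addr0 // => j ji.
  by rewrite -mulrA h0 ?mulr0.
have mphi : measurable_fun [set: borel G] phi.
  apply: measurable_sum => i; apply: measurable_funM => //.
have phi1 x : `|phi x| <= 1.
  (* On g_i^-1 W the sum is a single sign; outside all translates it is 0. *)
  have [[i Wi]|nW] := pselect (exists i, W (ltrans (g i) x)).
    have hi : h i x = 1 by rewrite /h indicE mem_set.
    by rewrite -[phi x]mulr1 -hi phih hi mulr1 normrX normrN1 expr1n.
  rewrite /phi big1 ?normr0 // => i _; rewrite /h indicE memNset ?mulr0 //.
  by move=> Wi; apply: nW; exists i.
exists (Binf_integral mphi phi1) => i.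
(* Acting by [g i] shifts the test function, turning the indicator of W into [h i]. *)
rewrite -[LHS]/(integral_functional phi (L1_shift haar (g i) L1_indic)).
rewrite /L1_indic (L1_shiftE haar) (integral_functional_pi mphi phi1).
rewrite /integral_against; congr scalar_of.
  under eq_Rintegral do rewrite re_scalar_of -/(h i _) phih.
  rewrite RintegralZl //; last first.
    exact: (integrable_ltrans haar (g i) integrable_indic_fin).
  congr (_ * _); rewrite /Rintegral; congr fine.
  rewrite (integral_ltrans haar (g i) (f := fun x => (\1_W x)%:E)).
  - by rewrite integral_indic // setIT.
  - by apply/measurable_EFinP; exact: measurable_indic.
  - by move=> x; rewrite lee_fin.
under eq_Rintegral do rewrite im_scalar_of0 mulr0.
by rewrite Rintegral_cst // mul0r.
Qed.

End indicator.
End evaluation.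

(** * Disjoint translates and the entropy bound *)

(** Continuity of (x, y) -> x y^-1 at (1, 1). *)
Lemma nbhs1_div (G : topologicalGroupType) (T : set G) : nbhs (1%g : G) T ->
  exists W : set G, [/\ open W, W 1%g & forall x y, W x -> W y -> T (x / y)%g].
Proof.
move=> T1; pose d (p : G * G) : G := (p.1 / p.2)%g.
have cd : continuous d.
  move=> p; apply: (@continuous_comp (G * G)%type (G * G)%type G
    (fun p => (p.1, p.2^-1%g)) (fun p => (p.1 * p.2)%g)); last first.
    exact: mulg_continuous.
  apply: cvg_pair; first exact: cvg_fst.
  move=> A /(@invg_continuous G p.2) pA.
  exists (setT, (fun y : G => y^-1%g) @^-1` A) => [|[? ?] []//].
  by split=> //; exact: filterT.
have /(cd (1%g, 1%g))[[A B] /= [A1 B1] AB] : nbhs (d (1%g, 1%g)) T.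
  by rewrite /d /= divg1.
exists (A `&` B)°; split; first exact: open_interior.
  exact: nbhs_singleton (nbhs_interior (filterI A1 B1)).
move=> x y /interior_subset[Ax _] /interior_subset[_ By].
exact: (AB (x, y)).
Qed.

Theorem theorem5p6 (R : realType) (K : scalar_kind) (G : topologicalGroupType)
    (hausdorffG : hausdorff_space G)
    (locally_compactG : locally_compact [set: G])
    (compactly_generatedG : compactly_generated G)
    (mu : {measure set (borel G) -> \bar R}) (haar : left_haar mu)
    (S : set G) (compactS : compact S) (generatesS : generates S) :
  let N := [set n : nat | (0 < n)%N /\ nbhs (1%g : G) (setpow S n)] in
  let k : R := inf [set n%:R | n in N] in
  N !=set0 /\
  (~ compact [set: G] ->
   exists V : set (set (Binf K mu)),
     [/\ finite_open_covering V, #|` fset_set V| = 2%N &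
         (((2 * k)^-1)%:E <= entropy (canonical_action haar) S V)%E]).
Proof.
move=> N k; have N0 : N !=set0 by exact: setpow_nbhs1.
split=> // ncG.
have exN : exists n, `[< N n >] by have [n Nn] := N0; exists n; exact/asboolP.
case: (ex_minnP exN) => p /asboolP[p0 pS] pmin.
(* This inequality suffices: it gives 1/(2k) <= 1/(2p), so the bound can be proved for the natural
   number p. *)
have pk : p%:R <= k.
  apply: lb_le_inf => [|_ [n Nn <-]].
    by have [n Nn] := N0; exists n%:R, n.
  by rewrite ler_nat pmin //; exact/asboolP.
have [W [oW W1 WS]] := nbhs1_div pS.
have mW := borel_open oW.
have muW : (mu W < +oo)%E.
  (* Since 1 is in W, writing x = x / 1 places W inside the compact set S^p. *)
  apply: le_lt_trans (left_haar_compact haar (compact_setpow (n := p) compactS)).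
  apply: le_measure; [exact/mem_set| |].
    apply/mem_set; apply: (borel_compact hausdorffG).
    exact: compact_setpow.
  by move=> x Wx; rewrite -[x]divg1; exact: WS.
have muW0 : 0 < fine (mu W).
  by rewrite fine_gt0 // muW andbT (left_haar_open_gt0 hausdorffG haar oW W1).
pose val (b : bool) : scalars R K := scalar_of ((-1) ^+ b * fine (mu W)) 0.
have valI b c : val b = val c -> b = c.
  move=> /(congr1 scalar_re); rewrite !re_scalar_of.
  by move=> /(mulIf (lt0r_neq0 muW0)); case: b c => -[] //= H; lra.
pose F : L1 K mu := L1_indic mW muW.
pose U b := [set l : Binf K mu | l F <> val b].
(* Needed for the covering to have exactly two members: the case m = 1, g = 1 of [Binf_separate]
   gives a functional with value [val true] at F, which lies in [U false] only. *)
have UTF : U true <> U false.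
  have disj1 (i j : 'I_1) (x : G) : W (1 * x)%g -> W (1 * x)%g -> i = j.
    by rewrite !ord1.
  have [l /(_ ord0)] :=
    Binf_separate (k := K) mW muW haar (g := fun=> 1%g) disj1 (fun=> true).
  rewrite -/F -/(val true); set l' := canonical_action _ _ _ => l'T.
  move=> /seteqP[_ /(_ l')] TF; apply: (TF _ l'T).
  by rewrite /U /= l'T => /valI.
have VE : [set U b | b in setT] = [set U true; U false].
  apply/seteqP; split=> [_ [[] _ <-]|_ [->|->]]; [by left|by right| |].
    by exists true.
  by exists false.
exists [set U b | b in setT]; split.
- split.
  + by rewrite VE.
  + by move=> _ [b _ <-]; exact: open_Binf_eval_neq.
  + apply/seteqP; split=> // l _.
    have [lT|lT] := pselect (l F = val true); last first.
      by exists (U true) => //; exists true.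
    exists (U false); first by exists false.
    by rewrite /U /= lT => /valI.
- rewrite VE fset_setU // !fset_set1 cardfs2.
  by move: UTF => /eqP ->.
- have k0 : 0 < k by apply: lt_le_trans pk; rewrite ltr0n.
  apply: (@le_trans _ _ ((2 * p)%N%:R^-1)%:E).
    rewrite lee_fin natrM lef_pV2 ?posrE ?mulr_gt0 ?ltr0n //.
    by rewrite ler_pM2l // ltr0n.
  apply: entropy_ge => [|m]; first by rewrite muln_gt0.
  have [g [gS gsep]] := setpow_separated m compactS generatesS ncG p0.
  apply: (covering_number_ge gS) => s.
  (* A common point x of two translates would give g_i g_j^-1 = (g_i x)(g_j x)^-1 in S^p, and
     likewise with i and j exchanged; separation excludes this for the larger index first. *)
  have disj (i j : 'I_m) (x : G) : W (g i * x)%g -> W (g j * x)%g -> i = j.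
    move=> Wi Wj; apply/val_inj; apply/eqP; rewrite eqn_leq.
    apply/andP; split; rewrite leqNgt; apply/negP => /gsep; apply.
      by rewrite -(mulgKA x); exact: WS.
    by rewrite -(mulgKA x); exact: WS.
  have [l lP] := Binf_separate (k := K) mW muW haar disj s.
  (* [U b] omits exactly the functionals with value [val b] at F, so realizing the sign [s i] means
     avoiding [U (s i)]. *)
  by exists l => i; apply; exact: lP.
Qed.
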